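(* Let $\mathcal{H}$ be a real Hilbert space and let $T:\mathcal{H}\to\mathcal{H}$ be non-expansive with $0\in\overline{\mathrm{ran}(I-T)}\setminus\mathrm{ran}(I-T)$. Let $Q$ be the set of weak cosmic accumulation points of $T$. Then $$Q\subseteq\overline{\mathrm{cone}(\mathrm{ran}(T-I))}\cap\bigl(\overline{\mathrm{cone}(\mathrm{ran}(T-I))}\bigr)^*\subseteq Q^*.$$
   Context: $T$ is non-expansive if $\|T(x)-T(y)\|\le\|x-y\|$ for all $x,y$. $\mathrm{ran}(I-T)=\{x-T(x): x\in\mathcal{H}\}$, $\mathrm{ran}(T-I)=\{T(x)-x: x\in\mathcal{H}\}$, and the bar denotes norm closure. For $A\subseteq\mathcal{H}$, $\mathrm{cone}(A)=\{\lambda a:\lambda>0,\ a\in A\}$ is the conical hull, and $A^*=\{v\in\mathcal{H}:\langle v,a\rangle\ge0\text{ for any }a\in A\}$ is the dual cone. Since $T$ has no fixed point, any sequence given by $x^{k+1}=T(x^k)$ from a starting point $x^0\in\mathcal{H}$ satisfies $\|x^k\|\to\infty$. $Q$ is the set of weak accumulation points of $\{(1/\|x^k\|)x^k\}$ (considered for those $k$ with $x^k\neq0$), i.e. the set of $q\in\mathcal{H}$ such that some subsequence satisfies $(1/\|x^{k_j}\|)x^{k_j}\rightharpoonup q$ (weak convergence). This set does not depend on the choice of starting point $x^0$.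
   Formalization: The divergence ‖x^k‖→∞ of the orbit defining Q is assumed, not deduced from the absence of fixed points: in infinite dimension it can fail (Edelstein's isometry of ℓ²), and then the first inclusion is false. *)

(* Defs.v *)
From HB Require Import structures.
From mathcomp Require Import all_boot all_order all_algebra.
From mathcomp Require Import all_classical all_reals all_analysis.

Set Implicit Arguments.
Unset Strict Implicit.
Unset Printing Implicit Defensive.

Import Order.TTheory GRing.Theory Num.Theory.
Import numFieldNormedType.Exports.

Local Open Scope classical_set_scope.
Local Open Scope ring_scope.

(* A real Hilbert space is a complete normed module H over R together with a
   positive definite symmetric bilinear form dot inducing the norm of H. *)
Definition induces_norm (R : realType) (H : completeNormedModType R)
    (dot : {dot H for (@idfun R)}) : Prop :=
  forall x : H, `|x| = Num.sqrt (dot x x).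

Definition nonexpansive (R : realType) (H : completeNormedModType R)
    (T : H -> H) : Prop :=
  forall x y : H, `|T x - T y| <= `|x - y|.

(* The scalar is strictly positive, so 0 need not belong to cone A. *)
Definition cone (R : realType) (H : completeNormedModType R)
    (A : set H) : set H :=
  [set v | exists2 l : R, 0 < l & exists2 a, A a & v = l *: a].

Definition dual_cone (R : realType) (H : completeNormedModType R)
    (dot : {dot H for (@idfun R)}) (A : set H) : set H :=
  [set v | forall a, A a -> 0 <= dot v a].

Definition weak_cvg (R : realType) (H : completeNormedModType R)
    (dot : {dot H for (@idfun R)}) (u : nat -> H) (q : H) : Prop :=
  forall y : H, dot (u k) y @[k --> \oo] --> dot q y.

(* The set Q of weak cosmic accumulation points, computed from the orbit
   x^k = iter k T x0.  It is independent of x0 only when the orbits tend to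
   infinity in norm.  A fixed-point-free nonexpansive map need not have this
   property in infinite dimension: Edelstein's map
   (T x)_n = 1 + e^(2 pi i / n!) (x_n - 1), n >= 2, on l^2(C) satisfies
   0 \in closure (ran (I - T)) and has no fixed point, but T^(m!) x0 tends to
   x0 as m grows, so that x0 / |x0| is in Q for every x0 != 0, while
   cone (ran (T - I)) is dense.  Divergence of the orbit is therefore a
   separate assumption wherever Q is used. *)
Definition weak_cosmic_accumulation (R : realType)
    (H : completeNormedModType R) (dot : {dot H for (@idfun R)})
    (T : H -> H) (x0 : H) : set H :=
  [set q | exists phi : nat -> nat,
     [/\ increasing_seq phi,
         forall j, iter (phi j) T x0 != 0 &
         weak_cvg dot
           (fun j => `|iter (phi j) T x0|^-1 *: iter (phi j) T x0) q]].

(* Main.v *)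
(** Write x^k for the orbit and K for the closed cone of ran(T - I).  Starting
    the orbit y^k at an almost fixed point y changes x^k by at most |x0 - y|,
    which is negligible against |x^k|, but makes all the steps y^k - T y^k
    small.  Monotonicity of I - T at (y^k, x), divided by |x^k|, then gives
    <q, T x - x> >= 0 in the limit, so q lies in K^*.  Since I - T is maximal
    monotone, the closure of its range is convex, hence K is a convex cone; it
    contains (x^k - x^0)/|x^k|, so it contains the weak limit q.  The second
    inclusion is Q `<=` K dualised. *)

Require Import Defs.
From HB Require Import structures.
From mathcomp Require Import all_boot all_order all_algebra.
From mathcomp Require Import all_classical all_reals all_analysis.
From mathcomp Require Import ring lra.

Set Implicit Arguments.
Unset Strict Implicit.
Unset Printing Implicit Defensive.

Import Order.TTheory GRing.Theory Num.Theory.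
Import numFieldNormedType.Exports.

Local Open Scope classical_set_scope.
Local Open Scope ring_scope.

Section RealHilbert.
Variables (R : realType) (H : completeNormedModType R).
Variables (dot : {dot H for (@idfun R)}) (dot_norm : induces_norm dot).

(** * Inner product and Cauchy-Schwarz *)

(* Restatements of the [linear*] lemmas in which [dot] is not hidden behind its
   coercion to a bilinear map, so that they can be chained with [dotC]. *)
Lemma dotDl (x y z : H) : dot (x + y) z = dot x z + dot y z.
Proof. exact: linearDl. Qed.

Lemma dotDr (x y z : H) : dot z (x + y) = dot z x + dot z y.
Proof. exact: linearDr. Qed.

Lemma dotNl (x z : H) : dot (- x) z = - dot x z.
Proof. exact: linearNl. Qed.

Lemma dotNr (x z : H) : dot z (- x) = - dot z x.
Proof. exact: linearNr. Qed.

Lemma dotBl (x y z : H) : dot (x - y) z = dot x z - dot y z.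
Proof. exact: linearBl. Qed.

Lemma dotBr (x y z : H) : dot z (x - y) = dot z x - dot z y.
Proof. exact: linearBr. Qed.

Lemma dotZl (a : R) (x z : H) : dot (a *: x) z = a * dot x z.
Proof. exact: linearZl_LR. Qed.

Lemma dotZr (a : R) (x z : H) : dot z (a *: x) = a * dot z x.
Proof. exact: linearZr_LR. Qed.

Let dotE := (dotDl, dotDr, dotNl, dotNr, dotZl, dotZr).

Lemma dotC (x y : H) : dot x y = dot y x.
Proof. by rewrite hermC expr0 mul1r. Qed.

Lemma dotxx (x : H) : dot x x = `|x| ^+ 2.
Proof.
rewrite dot_norm sqr_sqrtr //; have [->|x0] := eqVneq x 0.
  by rewrite linear0l.
by apply: ltW; apply: neq0_dnorm_gt0.
Qed.

Lemma dot_le (x y : H) : dot x y <= `|x| * `|y|.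
Proof.
have [->|x0] := eqVneq x 0; first by rewrite linear0l normr0 mul0r.
have [->|y0] := eqVneq y 0; first by rewrite linear0r normr0 mulr0.
(* This square expands to 2 |x| |y| (|x| |y| - <x, y>). *)
have : 0 <= `|(`|y| *: x - `|x| *: y)| ^+ 2 by rewrite exprn_ge0.
rewrite -dotxx !dotE (dotC y x) !dotxx.
have xy0 : 0 < `|x| * `|y| by rewrite mulr_gt0 ?normr_gt0.
move=> h; rewrite -subr_ge0 -(pmulr_rge0 _ xy0); lra.
Qed.

Lemma dot_ge (x y : H) : - (`|x| * `|y|) <= dot x y.
Proof. by have := dot_le (- x) y; rewrite dotNl normrN; lra. Qed.

(** * Norm closure and weak limits of convex sets *)

Lemma closure_normP (A : set H) (x : H) :
  closure A x <-> forall e : R, 0 < e -> exists2 a, A a & `|x - a| < e.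
Proof.
split=> [Ax e e0|Ax B /nbhs_ballP[e /= e0 eB]].
  have [a [Aa]] := Ax _ (nbhsx_ballx x e e0).
  by rewrite -ball_normE /=; exists a.
have [a Aa xa] := Ax e e0; exists a; split=> //; apply: eB.
by rewrite -ball_normE.
Qed.

(* The projection of [q] on [K] is replaced by an approximate minimiser of the
   distance, so that completeness is not used. *)
Lemma mazur (K : set H) (q : H) (B : R) :
  (forall p u (t : R), K p -> K u -> 0 < t < 1 ->
     K ((1 - t) *: p + t *: u)) ->
  (forall v (e : R), 0 < e ->
     exists u, [/\ K u, `|u| <= B & dot v q - e <= dot v u]) ->
  closure K q.
Proof.
move=> Kconv Kq; apply/closure_normP => e e0.
pose S := [set `|q - u| ^+ 2 | u in K].
have Slb : has_lbound S by exists 0 => _ [u _ <-]; rewrite exprn_ge0.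
have Sinf : has_inf S.
  split=> //; have [u [Ku _ _]] := Kq 0 1 ltr01.
  by exists (`|q - u| ^+ 2), u.
pose d := inf S.
have d0 : 0 <= d.
  apply: lb_le_inf => [|_ [u _ <-]]; last exact: exprn_ge0.
  by case: Sinf.
have B0 : 0 <= B.
  by have [u [_ uB _]] := Kq 0 1 ltr01; apply: le_trans uB.
pose D := B + `|q| + d + 1.
(* [h] serves three times: [h ^+ 2] is the slack of the minimiser [p], [h] the error allowed for
   [u], and [h] the length of the step from [p] towards [u]. [D] will bound |u - p|. *)
pose h := e ^+ 2 / (e ^+ 2 + D ^+ 2 + 3).
have e20 : 0 < e ^+ 2 by rewrite exprn_gt0.
have D20 : 0 <= D ^+ 2 by rewrite exprn_even_ge0.
have h0 : 0 < h by rewrite divr_gt0 //; lra.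
have hE : h * (e ^+ 2 + D ^+ 2 + 3) = e ^+ 2.
  by rewrite divfK //; apply/eqP; lra.
have h1 : h < 1 by nra.
have [_ [p Kp <-] pd] := inf_adherent (exprn_gt0 2 h0) Sinf.
rewrite -/d in pd.
have qp : `|q - p| <= d + 1.
  have := normr_ge0 (q - p); nra.
have [u [Ku uB uq]] := Kq (q - p) h h0.
have up : `|u - p| <= D.
  have : `|u - p| <= `|u| + (`|q| + `|q - p|).
    rewrite (le_trans (ler_normB _ _)) // lerD2l.
    by rewrite -{1}(subKr q p) ler_normB.
  rewrite /D; lra.
have dp : d <= `|q - ((1 - h) *: p + h *: u)| ^+ 2.
  apply: ge_inf => //; exists ((1 - h) *: p + h *: u) => //.
  by apply: Kconv => //; rewrite h0.
have : `|q - ((1 - h) *: p + h *: u)| ^+ 2 =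
    `|q - p| ^+ 2 - 2 * h * dot (q - p) (u - p) + h ^+ 2 * `|u - p| ^+ 2.
  rewrite -!dotxx !dotE (dotC p q) (dotC u q) (dotC u p); ring.
move=> pE; exists p => //.
have up2 : `|u - p| ^+ 2 <= D ^+ 2.
  by rewrite ler_pXn2r ?nnegrE // (le_trans _ up).
(* [k1]: the step towards [u] lowers the squared distance to [q] by less than [h ^+ 2]. [k2]: [u]
   reaches almost as far as [q] in the direction q - p. Together they give |q - p|^2 <= h (3 + D^2)
   / 2 < e^2. *)
have k1 : 2 * dot (q - p) (u - p) <= h * (1 + `|u - p| ^+ 2).
  rewrite -(ler_pM2l h0); move: dp pd; rewrite pE; nra.
have k2 : `|q - p| ^+ 2 - h <= dot (q - p) (u - p).
  move: uq; rewrite -dotxx !dotBr; lra.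
have k3 : `|q - p| ^+ 2 < e ^+ 2 by nra.
by rewrite -(ltr_pXn2r (_ : 0 < 2)%N) ?nnegrE // ltW.
Qed.

Variables (T : H -> H) (T_nonexp : nonexpansive T).

(** * Monotonicity of I - T and near convexity of its range *)

Lemma nonexpansive_monotone (x y : H) :
  0 <= dot ((x - T x) - (y - T y)) (x - y).
Proof.
have -> : (x - T x) - (y - T y) = (x - y) - (T x - T y).
  by rewrite opprB [T y - y]addrC addrACA opprB [- T x + _]addrC.
rewrite dotBl dotxx.
have := dot_le (T x - T y) (x - y).
have := T_nonexp x y; have := normr_ge0 (x - y); nra.
Qed.

(** The equation says that z is a fixed point of z |-> (T z + u) / (1 + e), a contraction of ratio 1
    / (1 + e). *)
Lemma resolvent_exists (e : R) (u : H) : 0 < e ->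
  exists z, e *: z + (z - T z) = u.
Proof.
move=> e0; pose g (z : H) := (1 + e)^-1 *: (T z + u).
have gT : {homo g : x / [set: H] x >-> [set: H] x} by [].
have e10 : 0 < (1 + e)^-1 by rewrite invr_gt0; lra.
have [|||z _] := @banach_fixed_point R H setT (mkfun gT).
- exists (NngNum (ltW e10)); split => /=.
    by rewrite invf_lt1; lra.
  move=> [x y] _ /=; rewrite /g -scalerBr normrZ gtr0_norm // ler_pM2l //.
  by rewrite opprD addrACA subrr addr0 T_nonexp.
- exact: closedT.
- by exists 0.
move=> /= zE; exists z.
have : (1 + e) *: z = T z + u.
  by rewrite {1}zE /g scalerA divff ?scale1r //; apply/eqP; lra.
rewrite scalerDl scale1r addrA [_ + z]addrC => ->.
by rewrite addrAC subrr add0r.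
Qed.

(* [I - T] is maximal monotone, so its range is nearly convex: the resolvent
   solutions of [e z + (z - T z) = u] satisfy [e z -> 0] as [e -> 0]. *)
Lemma range_nearly_convex (x y : H) (t d : R) : 0 <= t <= 1 -> 0 < d ->
  exists z, `|t *: (x - T x) + (1 - t) *: (y - T y) - (z - T z)| < d.
Proof.
move=> /andP[t0 t1] d0.
set Ax := x - T x; set Ay := y - T y; set u := _ + _.
pose b := `|t *: x + (1 - t) *: y|.
pose c := `|t * dot (u - Ax) x + (1 - t) * dot (u - Ay) y|.
have b0 : 0 <= b by exact: normr_ge0.
have c0 : 0 <= c by exact: normr_ge0.
(* Chosen so that s^2 <= e (s b + c), which is [key] with s = |e z|, fails for every s >= d. *)
pose e := d ^+ 2 / (d * b + c + 1).
have den0 : 0 < d * b + c + 1 by nra.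
have e0 : 0 < e by rewrite divr_gt0 // exprn_gt0.
have eE : e * (d * b + c + 1) = d ^+ 2 by rewrite divfK //; apply/eqP; lra.
have [z zE] := resolvent_exists u e0; exists z.
have -> : u - (z - T z) = e *: z by rewrite -zE addrK.
have AzE : z - T z = u - e *: z by rewrite -zE [RHS]addrC addKr.
have hx := nonexpansive_monotone z x; have hy := nonexpansive_monotone z y.
rewrite AzE -/Ax -/Ay in hx hy.
have hb := dot_le (e *: z) (t *: x + (1 - t) *: y); rewrite -/b in hb.
have hc := ler_norm (- (t * dot (u - Ax) x + (1 - t) * dot (u - Ay) y)).
rewrite normrN -/c in hc.
(* Add the monotonicity inequalities at (z, x) and (z, y) with weights t and 1 - t. As [u] is the
   same convex combination of [Ax] and [Ay], the terms <u - Ax, z> and <u - Ay, z> cancel ([uz]). *)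
have key : `|e *: z| ^+ 2 <= e * (`|e *: z| * b + c).
  have uz : t * dot (u - Ax) z + (1 - t) * dot (u - Ay) z = 0.
    rewrite /u !dotE; ring.
  have -> : `|e *: z| ^+ 2 = e * dot (e *: z) z.
    by rewrite -dotxx dotZr.
  rewrite ler_pM2l //.
  have txy : 0 <= t * dot (u - e *: z - Ax) (z - x)
                + (1 - t) * dot (u - e *: z - Ay) (z - y).
    by rewrite addr_ge0 // mulr_ge0 // subr_ge0.
  have E w v : dot (u - e *: z - w) v = dot (u - w) v - dot (e *: z) v.
    by rewrite addrAC dotBl.
  rewrite !E !(dotBr z) in txy.
  rewrite dotDr !dotZr in hb.
  lra.
rewrite ltNge; apply/negP => dz.
set s := `|e *: z| in key dz.
have : s ^+ 2 * (d * b + c + 1) <= d ^+ 2 * (s * b + c).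
  by rewrite -eE [leRHS]mulrAC ler_pM2r.
have : 0 <= d * b * s * (s - d) by rewrite !mulr_ge0 //; lra.
have : 0 <= c * ((s - d) * (s + d)) by rewrite !mulr_ge0 //; lra.
have : 0 < s ^+ 2 by rewrite exprn_gt0 //; lra.
nra.
Qed.

(** * Convexity of the closed cone *)

Local Notation K := (closure (cone (range (fun x => T x - x)))).

Lemma closure_coneZ (l : R) (a : H) : 0 < l -> K a -> K (l *: a).
Proof.
move=> l0 /closure_normP Ka; apply/closure_normP => e e0.
have [_ [m m0 [b Tb ->]] ab] := Ka (e / l) (divr_gt0 e0 l0).
exists (l *: (m *: b)); first exists (l * m).
- exact: mulr_gt0.
- by exists b; rewrite ?scalerA.
by rewrite -scalerBr normrZ gtr0_norm // mulrC -ltr_pdivlMr.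
Qed.

(** A sum l (T x - x) + m (T y - y) is l + m times a convex combination of displacements, which near
    convexity of the range replaces by a single displacement. *)
Lemma closure_coneD (a b : H) : K a -> K b -> K (a + b).
Proof.
move=> /closure_normP Ka /closure_normP Kb; apply/closure_normP => e e0.
have e30 : 0 < e / 3 by lra.
have [_ [l l0 [_ [x _ <-] ->]] al] := Ka _ e30.
have [_ [m m0 [_ [y _ <-] ->]] bm] := Kb _ e30.
have lm0 : 0 < l + m by lra.
have lmN0 : l + m != 0 by apply/eqP; lra.
have [||z hz] := @range_nearly_convex x y (l / (l + m)) (e / 3 / (l + m)).
- by rewrite divr_ge0 ?(ltW l0) ?(ltW lm0) // ler_pdivrMr //=; lra.
- by rewrite divr_gt0.
exists ((l + m) *: (T z - z)).
  by exists (l + m) => //; exists (T z - z) => //; exists z.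
have uE : (l + m) *: (l / (l + m) *: (x - T x)
                      + (1 - l / (l + m)) *: (y - T y)) =
    - (l *: (T x - x) + m *: (T y - y)).
  rewrite -(opprB (T x)) -(opprB (T y)) !scalerN -opprD scalerN scalerDr.
  rewrite !scalerA mulrBr mulr1 [(l + m) * _]mulrC divfK //.
  by rewrite [l + m - l]addrAC subrr add0r.
have -> : a + b - (l + m) *: (T z - z) =
    (a - l *: (T x - x)) + (b - m *: (T y - y))
    - (l + m) *: (l / (l + m) *: (x - T x) + (1 - l / (l + m)) *: (y - T y)
                  - (z - T z)).
  rewrite (scalerBr (l + m) (_ + _)) uE; set P := l *: _ + _.
  rewrite -(opprB (T z)) scalerN opprK opprD opprK.
  by rewrite [a - _ + _]addrACA -opprD addrA subrK.
rewrite (le_lt_trans (ler_normB _ _)) // normrZ gtr0_norm //.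
have := ler_normD (a - l *: (T x - x)) (b - m *: (T y - y)).
move: hz; rewrite ltr_pdivlMr // mulrC; lra.
Qed.

(** * Almost fixed points and orbits *)

Variable T_cl : closure (range (fun x => x - T x)) 0.

Lemma almost_fixed (e : R) : 0 < e -> exists y, `|y - T y| < e.
Proof.
move=> e0; have /closure_normP /(_ _ e0) [_ [y _ <-]] := T_cl.
by rewrite sub0r normrN; exists y.
Qed.

Lemma orbit_sub_cone (x0 : H) k : K (iter k T x0 - x0).
Proof.
elim: k => [|k IHk].
  (* Scalars in [cone] are positive, so 0 is reached as a limit of displacements of almost fixed
     points. *)
  rewrite subrr; apply/closure_normP => e /almost_fixed[y ye].
  exists (T y - y); last by rewrite sub0r opprB.
  by exists 1 => //; exists (T y - y); rewrite ?scale1r.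
have -> : iter k.+1 T x0 - x0 =
    (T (iter k T x0) - iter k T x0) + (iter k T x0 - x0).
  by rewrite addrA subrK.
apply: closure_coneD => //; apply: subset_closure.
by exists 1 => //; exists (T (iter k T x0) - iter k T x0); rewrite ?scale1r.
Qed.

Lemma orbit_dist (x y : H) k : `|iter k T x - iter k T y| <= `|x - y|.
Proof. by elim: k => //= k; apply: le_trans. Qed.

Lemma orbit_step (y : H) k : `|iter k T y - iter k.+1 T y| <= `|y - T y|.
Proof. by rewrite iterSr orbit_dist. Qed.

(** * Weak cosmic accumulation points *)

Variables (x0 q : H).
Hypothesis orbit_oo : `|iter k T x0| @[k --> \oo] --> +oo.
Hypothesis Qq : weak_cosmic_accumulation dot T x0 q.

(** Reduces weak convergence, tested on one vector, to a single index. The bound [M] makes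
    quantities independent of k negligible after division by |x^k|. *)
Lemma cosmic_approx (v : H) (e M : R) : 0 < e -> exists k : nat,
  [/\ 0 < `|iter k T x0|, M <= `|iter k T x0| &
      `|dot v q - `|iter k T x0|^-1 * dot v (iter k T x0)| < e].
Proof.
move=> e0; have [phi [phi_inc phi0 phiq]] := Qq.
have phi_oo : phi j @[j --> \oo] --> \oo.
  have phi_ge j : (j <= phi j)%N.
    elim: j => // j /leq_ltn_trans; apply.
    by rewrite ltnNge -leEnat phi_inc -ltnNge.
  apply/cvgnyPge => A; near=> j; apply: leq_trans (phi_ge j).
  by near: j; exact: nbhs_infty_ge.
have /cvgryPge/(_ M) hM := cvg_comp _ _ phi_oo orbit_oo.
have /cvgrPdist_lt/(_ _ e0) he := phiq v.
near \oo => j; exists (phi j); split.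
- by rewrite normr_gt0.
- by near: j.
- have : `|dot q v - dot (`|iter (phi j) T x0|^-1 *: iter (phi j) T x0) v| < e.
    by near: j.
  by rewrite dotZl (dotC q) (dotC _ v).
Unshelve. all: by end_near.
Qed.

Lemma cosmic_in_cone : K q.
Proof.
have -> : K = closure K.
  by apply/closure_id; exact: closed_closure.
apply: (@mazur _ _ 2) => [p u t Kp Ku /andP[t0 t1]|v e e0].
  by apply: closure_coneD; apply: closure_coneZ; rewrite ?subr_gt0.
have e20 : 0 < e / 2 by lra.
(* The first summand of the threshold gives |x - x0| / n <= 2, the bound passed to [mazur]; the
   second gives <v, x0> / n <= e / 2. *)
have [k] := @cosmic_approx v (e / 2) (`|x0| + 2 * (`|v| * `|x0|) / e) e20.
set x := iter k T x0; set n := `|x| => -[n0 nM nq].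
have n'0 : 0 < n^-1 by rewrite invr_gt0.
have vx0 : 0 <= 2 * (`|v| * `|x0|) / e by rewrite !mulr_ge0 ?invr_ge0 // ltW.
exists (n^-1 *: (x - x0)); split.
- by apply: closure_coneZ => //; apply: orbit_sub_cone.
- rewrite normrZ gtr0_norm // mulrC ler_pdivrMr //.
  by rewrite (le_trans (ler_normB _ _)) // -/n; lra.
- rewrite dotZr dotBr mulrBr.
  have : n^-1 * dot v x0 <= e / 2.
    rewrite mulrC ler_pdivrMr // (le_trans (dot_le _ _)) //.
    have : 2 * (`|v| * `|x0|) / e <= n by have := normr_ge0 x0; lra.
    by rewrite ler_pdivrMr //; lra.
  by move: nq; rewrite ltr_norml => /andP[_]; lra.
Qed.

Lemma cosmic_displacement (x : H) : 0 <= dot q (T x - x).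
Proof.
set v := T x - x; apply/ler_addgt0Pr => e e0.
have e30 : 0 < e / 3 by lra.
have [y ye] := almost_fixed e30.
(* [C] collects the terms of the monotonicity inequality that do not grow with k; n >= 3 C / e makes
   C / n <= e / 3. The other two thirds of [e] pay for the orbit step |w - T w| and for the weak
   approximation. *)
pose C := e / 3 * (`|x| + `|y - x0|) + `|v| * (`|x| + `|y - x0|).
have C0 : 0 <= C by rewrite /C -mulrDl mulr_ge0 ?addr_ge0 // ltW.
have [k] := @cosmic_approx v (e / 3) (3 * C / e) e30.
set xk := iter k T x0; set n := `|xk| => -[n0 nM nq].
pose w := iter k T y.
have wx : `|w - xk| <= `|y - x0| by exact: orbit_dist.
have ww : `|w - T w| <= e / 3 by apply: le_trans (orbit_step y k) (ltW ye).
have := nonexpansive_monotone w x.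
have -> : w - T w - (x - T x) = (w - T w) + v by rewrite opprB.
rewrite dotDl.
have h1 : dot (w - T w) (w - x) <= e / 3 * (n + `|y - x0| + `|x|).
  apply: (le_trans (dot_le _ _)); apply: ler_pM => //.
  rewrite (le_trans (ler_normB _ _)) // lerD2r.
  by rewrite -(subrK xk w) addrC (le_trans (ler_normD _ _)) // lerD2l.
have h2 : dot v (w - x) <= dot v xk + `|v| * (`|x| + `|y - x0|).
  have -> : w - x = xk + ((w - xk) - x) by rewrite addrA addrCA subrr addr0.
  rewrite dotDr lerD2l (le_trans (dot_le _ _)) // ler_wpM2l //.
  by rewrite (le_trans (ler_normB _ _)) // addrC lerD2l.
move=> h3.
have h4 : 0 <= dot v xk + e / 3 * n + C by rewrite /C; lra.
have h5 : C <= e / 3 * n by move: nM; rewrite ler_pdivrMr //; lra.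
have h6 : - (e / 3 + e / 3) <= n^-1 * dot v xk.
  by rewrite [leRHS]mulrC ler_pdivlMr //; lra.
by move: nq; rewrite (dotC q) ltr_norml => /andP[]; lra.
Qed.

Lemma cosmic_in_dual : dual_cone dot K q.
Proof.
move=> a /closure_normP Ka; apply/ler_addgt0Pr => e e0.
(* The added 1 keeps the tolerance e / (|q| + 1) meaningful when q = 0. *)
have q10 : 0 < `|q| + 1 by rewrite ltr_wpDl.
have [_ [l l0 [_ [x _ <-] ->]] ab] := Ka (e / (`|q| + 1)) (divr_gt0 e0 q10).
have := mulr_ge0 (ltW l0) (cosmic_displacement x).
have := dot_ge q (a - l *: (T x - x)).
rewrite dotBr dotZr.
move: ab; rewrite ltr_pdivlMr //.
have := normr_ge0 (a - l *: (T x - x)); lra.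
Qed.

End RealHilbert.

Theorem theorem5p4 (R : realType) (H : completeNormedModType R)
    (dot : {dot H for (@idfun R)}) (dot_norm : induces_norm dot)
    (T : H -> H) (T_nonexp : nonexpansive T)
    (T_ran : (closure (range (fun x => x - T x)) `\`
              range (fun x => x - T x)) 0)
    (x0 : H) (orbit_oo : `|iter k T x0| @[k --> \oo] --> +oo) :
  let Q := weak_cosmic_accumulation dot T x0 in
  let K := closure (cone (range (fun x => T x - x))) in
  Q `<=` K `&` dual_cone dot K /\ K `&` dual_cone dot K `<=` dual_cone dot Q.
Proof.
have [T_cl _] := T_ran.
split=> [q Qq|v [_ Kv] q Qq].
  split; first exact: (cosmic_in_cone dot_norm T_nonexp T_cl orbit_oo Qq).
  exact: (cosmic_in_dual dot_norm T_nonexp T_cl orbit_oo Qq).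
by apply: Kv; apply: (cosmic_in_cone dot_norm T_nonexp T_cl orbit_oo Qq).
Qed.
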